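(* Let $x>0$ and $r>0$ be real numbers with $x\neq r^2$, and let $\{u_n\}_{n\ge 0}$ be the sequence defined by $$u_0=r,\qquad u_{n+1}=\frac{u_n}{2}+\frac{x}{2u_n}\quad (n\ge 0).$$ Then for every integer $n\ge 1$, $$u_n=\frac{x+r^2}{2r}-\frac{x-r^2}{2r}\sum_{k=1}^{n-1}\frac{1}{2^k\prod_{j=0}^{k-1}T_{2^j}\left(\frac{x+r^2}{x-r^2}\right)}.$$ Furthermore, setting $b=\frac{x-r^2}{2}$ and $M=\frac{x+r^2}{2}$, for every $n\ge 1$, $$u_n=\frac{M}{r}-\frac{b}{r}\sum_{k=1}^{n-1}\frac{1}{2^k\prod_{j=0}^{k-1}T_{2^j}\left(\frac{M}{b}\right)},$$ and, over a common denominator, $$u_n=\frac{b}{r}\cdot\frac{T_{2^{n-1}}\left(\frac{M}{b}\right)}{2^{n-1}\prod_{j=0}^{n-2}T_{2^j}\left(\frac{M}{b}\right)}.$$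
   Context: $T_k$ denotes the Chebyshev polynomial of the first kind: $T_0(X)=1$, $T_1(X)=X$, $T_{k+1}(X)=2XT_k(X)-T_{k-1}(X)$. Empty sums equal $0$ and empty products equal $1$. *)

(* Defs.v *)
From mathcomp Require Import all_boot all_order all_algebra.

Set Implicit Arguments.
Unset Strict Implicit.
Unset Printing Implicit Defensive.

Import GRing.Theory.
Local Open Scope ring_scope.

Fixpoint chebyshevT (R : nzRingType) (k : nat) : {poly R} :=
  match k with
  | 0 => 1
  | k1.+1 =>
      match k1 with
      | 0 => 'X
      | k2.+1 => 2 *: 'X * chebyshevT R k1 - chebyshevT R k2
      end
  end.

(* Main.v *)
Require Import Defs.
From mathcomp Require Import all_boot all_order all_algebra.
From mathcomp Require Import reals.
From mathcomp Require Import ring lra.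

Set Implicit Arguments.
Unset Strict Implicit.
Unset Printing Implicit Defensive.

Import Order.TTheory GRing.Theory Num.Theory.
Local Open Scope ring_scope.

(** The argument rests on the doubling formula [T_(2n) = 2 T_n ^ 2 - 1]: at a
    fixed point [y], the values [t_j = T_(2^j)(y)] satisfy
    [t_(j+1) = 2 t_j ^ 2 - 1].  Put [P_m = 2 ^ m t_0 ... t_(m-1)], which is
    [U_(2^m - 1)(y)] for the Chebyshev polynomials [U] of the second kind.
    Then Pell's equation [t_m ^ 2 - 1 = (y ^ 2 - 1) P_m ^ 2] holds
    ([doubling_pell]).

    For [y = M / b] one has [M ^ 2 - b ^ 2 = x r ^ 2], so that Pell's equation
    reads [b ^ 2 (t_m ^ 2 - 1) = x r ^ 2 P_m ^ 2].  If [u = (b / r) (t_m / P_m)],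
    this is exactly what turns [u / 2 + x / (2 u)] into
    [(b / r) (2 t_m ^ 2 - 1) / (2 t_m P_m) = (b / r) (t_(m+1) / P_(m+1))]: a
    Newton step is one doubling step ([newton_step_pell]).  Since
    [u_1 = M / r = (b / r) t_0], the closed form follows by induction.

    The two sums come from the same recurrence, because
    [t_m / P_m - t_(m+1) / P_(m+1) = 1 / P_(m+1)] telescopes
    ([doubling_quotient_sum]).  No denominator vanishes: [y ^ 2 - 1] is positive
    as [x] is, so Pell's equation gives [t_m ^ 2 >= 1]. *)

(** The polynomial form of [2 cos a cos b = cos (a + b) + cos (a - b)].  Indexing
    by the difference [d] avoids truncated subtraction, and lets the two-step
    induction on [n] use the hypothesis at other values of [d]. *)
Lemma chebyshevT_mul (R : comNzRingType) (n d : nat) :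
  chebyshevT R (n + n + d) + chebyshevT R d
    = 2 * chebyshevT R n * chebyshevT R (n + d).
Proof.
have rec k : chebyshevT R k.+2 = 2 * 'X * chebyshevT R k.+1 - chebyshevT R k.
  by rewrite mulr_natl -['X *+ 2]scaler_nat.
suff: forall d, chebyshevT R (n + n + d) + chebyshevT R d
         = 2 * chebyshevT R n * chebyshevT R (n + d)
      /\ chebyshevT R (n.+1 + n.+1 + d) + chebyshevT R d
         = 2 * chebyshevT R n.+1 * chebyshevT R (n.+1 + d).
  by move/(_ d) => [].
elim: n {d} => [|n IHn] d.
  split; first by rewrite !add0n [chebyshevT R 0]/=; ring.
  rewrite !addSn !add0n rec [chebyshevT R 1]/=; ring.
split; first by case: (IHn d).
have [_ E1] := IHn d.+1; have [E0 _] := IHn d.+2.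
move: E1 E0; rewrite !addnS !addSn.
rewrite (rec (n + n + d).+2) (rec n) (rec d).
set A := chebyshevT R (n + n + d).+3; set B := chebyshevT R (n + n + d).+2.
set C := chebyshevT R (n + d).+2.
move=> E1 E0.
have -> : 2 * (2 * 'X * chebyshevT R n.+1 - chebyshevT R n) * C
  = 2 * 'X * (2 * chebyshevT R n.+1 * C) - 2 * chebyshevT R n * C by ring.
rewrite -E1 -E0; ring.
Qed.

Lemma chebyshevT_double (R : comNzRingType) (n : nat) :
  chebyshevT R (n + n) = 2 * chebyshevT R n ^+ 2 - 1.
Proof.
have := chebyshevT_mul R n 0; rewrite !addn0 [chebyshevT R 0]/= => E.
by rewrite expr2 mulrA -E addrK.
Qed.

Lemma horner_chebyshevT_exp2S (R : comNzRingType) (y : R) (j : nat) :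
  (chebyshevT R (2 ^ j.+1)).[y] = 2 * (chebyshevT R (2 ^ j)).[y] ^+ 2 - 1.
Proof.
rewrite expnS mul2n -addnn chebyshevT_double.
by rewrite -polyC1 -(polyC_natr R 2) hornerD hornerN hornerCM hornerC horner_exp.
Qed.

Definition doublingProd (R : nzRingType) (t : nat -> R) (m : nat) : R :=
  2 ^+ m * \prod_(0 <= j < m) t j.

Lemma doublingProd0 (R : nzRingType) (t : nat -> R) : doublingProd t 0 = 1.
Proof. by rewrite /doublingProd big_nil mulr1. Qed.

Lemma doublingProdS (R : comNzRingType) (t : nat -> R) (m : nat) :
  doublingProd t m.+1 = 2 * t m * doublingProd t m.
Proof. by rewrite /doublingProd big_nat_recr //= exprS; ring. Qed.

(** A doubling multiplies [t ^ 2 - 1] by the square [(2 t) ^ 2], since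
    [(2 t ^ 2 - 1) ^ 2 - 1 = (2 t) ^ 2 (t ^ 2 - 1)]. *)
Lemma doubling_pell (R : comNzRingType) (t : nat -> R) (m : nat) :
  (forall j, t j.+1 = 2 * t j ^+ 2 - 1) ->
  t m ^+ 2 - 1 = (t 0%N ^+ 2 - 1) * doublingProd t m ^+ 2.
Proof.
move=> tS; elim: m => [|m IHm]; first by rewrite doublingProd0 expr1n mulr1.
rewrite tS doublingProdS.
have -> : (2 * t m ^+ 2 - 1) ^+ 2 - 1 = (2 * t m) ^+ 2 * (t m ^+ 2 - 1) by ring.
by rewrite IHm; ring.
Qed.

Lemma doubling_neq0 (R : realDomainType) (t : nat -> R) (m : nat) :
  (forall j, t j.+1 = 2 * t j ^+ 2 - 1) -> 1 <= t 0%N ^+ 2 -> t m != 0.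
Proof.
move=> tS t0_ge1; apply/eqP => tm0.
have := doubling_pell m tS; rewrite tm0 expr0n /= => E.
have : 0 <= (t 0%N ^+ 2 - 1) * doublingProd t m ^+ 2.
  by rewrite mulr_ge0 ?sqr_ge0 // subr_ge0.
by rewrite -E; lra.
Qed.

Lemma doublingProd_neq0 (R : numDomainType) (t : nat -> R) (m : nat) :
  (forall j, t j != 0) -> doublingProd t m != 0.
Proof.
move=> t_neq0; elim: m => [|m IHm]; first by rewrite doublingProd0 oner_eq0.
by rewrite doublingProdS mulf_neq0 // mulf_neq0 ?pnatr_eq0.
Qed.

(** The sum telescopes: with [P] the product in the denominators,
    [t m / P m = 2 t m ^ 2 / P (m+1)], and this exceeds [t (m+1) / P (m+1)] by
    [1 / P (m+1)]. *)
Lemma doubling_quotient_sum (R : numFieldType) (t : nat -> R) (m : nat) :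
  (forall j, t j.+1 = 2 * t j ^+ 2 - 1) -> (forall j, t j != 0) ->
  t m / doublingProd t m
    = t 0%N - \sum_(1 <= k < m.+1) 1 / doublingProd t k.
Proof.
move=> tS t_neq0; elim: m => [|m IHm].
  by rewrite doublingProd0 divr1 big_geq // subr0.
rewrite big_nat_recr //= opprD addrA -IHm doublingProdS tS.
have tm := t_neq0 m; have Pm := doublingProd_neq0 m t_neq0.
by field; rewrite tm Pm.
Qed.

(** Pell's equation says [x = (b / (r P)) ^ 2 (t ^ 2 - 1)], which makes the
    Newton step for the square root of [x] rational in [t]. *)
Lemma newton_step_pell (R : numFieldType) (x r b t P : R) :
  r != 0 -> b != 0 -> t != 0 -> P != 0 ->
  b ^+ 2 * (t ^+ 2 - 1) = x * r ^+ 2 * P ^+ 2 ->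
  b / r * (t / P) / 2 + x / (2 * (b / r * (t / P)))
    = b / r * ((2 * t ^+ 2 - 1) / (2 * t * P)).
Proof.
move=> r0 b0 t0 P0 E.
have -> : x = b ^+ 2 * (t ^+ 2 - 1) / (r ^+ 2 * P ^+ 2).
  by rewrite E; field; rewrite r0 P0.
by field; rewrite r0 b0 t0 P0.
Qed.

(** The formula starts at [u 1], since a starting value [u 0 = r] is not of this
    form: the first Newton step is what brings it to [M / r = (b / r) t_0]. *)
Lemma newton_doubling (R : numFieldType) (x r b : R) (t u : nat -> R) (m : nat) :
  r != 0 -> b != 0 -> (forall j, t j != 0) ->
  (forall j, t j.+1 = 2 * t j ^+ 2 - 1) ->
  b ^+ 2 * (t 0%N ^+ 2 - 1) = x * r ^+ 2 ->
  u 1%N = b / r * t 0%N ->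
  (forall n, u n.+1 = u n / 2 + x / (2 * u n)) ->
  u m.+1 = b / r * (t m / doublingProd t m).
Proof.
move=> r0 b0 t_neq0 tS pell0 u1 uS; elim: m => [|m IHm].
  by rewrite u1 doublingProd0 divr1.
rewrite uS IHm newton_step_pell ?doublingProdS ?tS ?doublingProd_neq0 //.
by rewrite (doubling_pell m tS) mulrA pell0.
Qed.

Theorem theorem1 (R : realType) (x r : R) (u : nat -> R)
  (x_gt0 : 0 < x) (r_gt0 : 0 < r) (x_neq : x <> r ^+ 2)
  (u0 : u 0%N = r)
  (uS : forall n : nat, u n.+1 = u n / 2 + x / (2 * u n)) :
  (forall n : nat, (1 <= n)%N ->
     u n = (x + r ^+ 2) / (2 * r)
           - (x - r ^+ 2) / (2 * r)
             * \sum_(1 <= k < n)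
                 1 / (2 ^+ k * \prod_(0 <= j < k)
                        (chebyshevT R (2 ^ j)).[(x + r ^+ 2) / (x - r ^+ 2)]))
  /\
  (let b := (x - r ^+ 2) / 2 in
   let M := (x + r ^+ 2) / 2 in
   forall n : nat, (1 <= n)%N ->
     u n = M / r
           - b / r
             * \sum_(1 <= k < n)
                 1 / (2 ^+ k * \prod_(0 <= j < k) (chebyshevT R (2 ^ j)).[M / b])
     /\
     u n = b / r
           * ((chebyshevT R (2 ^ n.-1)).[M / b]
              / (2 ^+ n.-1 * \prod_(0 <= j < n.-1) (chebyshevT R (2 ^ j)).[M / b]))).
Proof.
have r0 : r != 0 by rewrite gt_eqF.
have d0 : x - r ^+ 2 != 0 by rewrite subr_eq0; apply/eqP.
pose b := (x - r ^+ 2) / 2; pose M := (x + r ^+ 2) / 2.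
have b0 : b != 0 by rewrite mulf_neq0 // invr_eq0 pnatr_eq0.
have Mb : (x + r ^+ 2) / (x - r ^+ 2) = M / b by rewrite /M /b; field.
pose t j := (chebyshevT R (2 ^ j)).[M / b].
have tS j : t j.+1 = 2 * t j ^+ 2 - 1 by apply: horner_chebyshevT_exp2S.
have t0E : t 0%N = M / b by rewrite /t expn0 hornerX.
have pell0 : b ^+ 2 * (t 0%N ^+ 2 - 1) = x * r ^+ 2.
  have -> : b ^+ 2 * (t 0%N ^+ 2 - 1) = M ^+ 2 - b ^+ 2 by rewrite t0E; field.
  by rewrite /M /b; field.
have t0_ge1 : 1 <= t 0%N ^+ 2.
  rewrite -subr_ge0 -(pmulr_rge0 _ (_ : 0 < b ^+ 2)) ?exprn_even_gt0 //.
  by rewrite pell0 mulr_ge0 ?sqr_ge0 // ltW.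
have t_neq0 j : t j != 0 by apply: doubling_neq0.
have u1 : u 1%N = b / r * t 0%N.
  have -> : b / r * t 0%N = M / r by rewrite t0E; field; rewrite r0 b0.
  by rewrite uS u0 /M; field.
have quot m : u m.+1 = b / r * (t m / doublingProd t m).
  exact: newton_doubling pell0 u1 uS.
have sum m : u m.+1 = M / r
    - b / r * \sum_(1 <= k < m.+1) 1 / doublingProd t k.
  by rewrite quot doubling_quotient_sum // t0E; field; rewrite r0 b0.
split.
  case=> // m _; rewrite Mb sum.
  by congr (_ - _ * _); rewrite /M /b; field.
by move=> b' M' [//|m] _; split; [apply: sum | apply: quot].
Qed.
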